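(* Let $k \geq 2$ be an integer and let $H_{1c}$ be a non-2-colorable $(k-1)$-uniform hypergraph. Then $$m(3k+1) \leq \left(m(k-1) + 2^{k-1}\right) m(k+1)^2 + 2\, m_{H_{1c}}(k+1)\, m(k)^2 + 4\, m(k+1)\, m(k)^2.$$
   Context: A hypergraph $H=(V,E)$ consists of a finite vertex set $V$ and a set $E$ of subsets of $V$ (hyperedges); it is $n$-uniform if every hyperedge has exactly $n$ vertices. A 2-coloring of $H$ assigns one of two colors (red, blue) to each vertex; it is proper if no hyperedge is monochromatic. $H$ is non-2-colorable if it has no proper 2-coloring. For an integer $n \geq 1$, $m(n)$ denotes the minimum number of hyperedges in a non-2-colorable $n$-uniform hypergraph. Abbott-Hanson-Toft construction: let $n \geq 3$ and let $C=(V_c,E_c)$ be a non-2-colorable $(n-2)$-uniform hypergraph (the core hypergraph) with $E_c=\{e_1,\dots,e_{m_c}\}$. Let $A=\{a_1,\dots,a_n\}$ and $B=\{b_1,\dots,b_n\}$ be disjoint vertex sets, each disjoint from $V_c$. For $K \subset \{1,\dots,n\}$ let $A_K=\{a_i : i\in K\}$, $B_K=\{b_i: i \in K\}$, $\overline{A}_K=A\setminus A_K$, $\overline{B}_K = B\setminus B_K$. The construction is the $n$-uniform hypergraph with vertex set $V_c\cup A\cup B$ and hyperedges: (i) $e_i\cup\{a_j\}\cup\{b_j\}$ for all $1\le i\le m_c$, $1\le j\le n$; (ii) $A_K\cup\overline{B}_K$ for each $K$ with $|K|$ odd and $1\le |K|\le\lfloor n/2\rfloor$; (iii) $\overline{A}_K\cup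 B_K$ for each $K$ with $|K|$ even and $2\le|K|\le\lfloor n/2\rfloor$; (iv) $A$. The number of hyperedges of this hypergraph is denoted $m_C(n)$; it equals $2^{n-1}+n\,m_c$ for odd $n$ and $2^{n-1}+n\,m_c+\frac12\binom{n}{n/2}$ for even $n$. Thus $m_{H_{1c}}(k+1)$ is the number of hyperedges of the Abbott-Hanson-Toft construction with $n=k+1$ and core $H_{1c}$. *)

(* Defs.v *)
From HB Require Import structures.
From mathcomp Require Import all_boot.
From mathcomp Require Import boolp.

Set Implicit Arguments.
Unset Strict Implicit.
Unset Printing Implicit Defensive.

Record hypergraph := Hypergraph {
  vertex :> finType;
  edges : {set {set vertex}}
}.

Definition uniform (n : nat) (H : hypergraph) : bool :=
  [forall e in edges H, #|e| == n].

(* With this definition the empty set is monochromatic; this only matters for *)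
(* 0-uniform hypergraphs.                                                     *)
Definition monochromatic (V : finType) (c : {ffun V -> bool}) (e : {set V}) :
  bool := [exists b : bool, [forall x in e, c x == b]].

Definition proper_coloring (H : hypergraph) (c : {ffun H -> bool}) : bool :=
  [forall e in edges H, ~~ monochromatic c e].

Definition two_colorable (H : hypergraph) : bool :=
  [exists c : {ffun H -> bool}, proper_coloring c].

Definition realizable (n q : nat) : Prop :=
  exists H : hypergraph,
    [/\ uniform n H, ~~ two_colorable H & #|edges H| = q].

(* The hypergraph of all n-subsets of a 2n-set is a witness. *)
Lemma realizable_ex (n : nat) : exists q : nat, `[< realizable n q >].
Proof.
pose H := Hypergraph [set e : {set 'I_(n + n)} | #|e| == n].
exists #|edges H|; apply/asboolP; exists H; split=> //.
  by apply/forall_inP => e; rewrite inE.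
apply/existsPn => c; apply/negP => /forall_inP cP.
have [b nb] : exists b : bool, n <= #|[set x | c x == b]|.
  have := cardsC [set x | c x == true]; rewrite card_ord => cE.
  have [le_n|lt_n] := leqP n #|[set x | c x == true]|; first by exists true.
  exists false.
  have -> : [set x | c x == false] = ~: [set x | c x == true].
    by apply/setP => x; rewrite !inE; case: (c x).
  by rewrite -(leq_add2l #|[set x | c x == true]|) cE leq_add2r ltnW.
have [e /subsetP sub_e ce] : exists2 e : {set 'I_(n + n)},
    e \subset [set x | c x == b] & #|e| == n.
  have : 0 < #|[set e : {set 'I_(n + n)} | e \subset [set x | c x == b]
                                          & #|e| == n]|.
    by rewrite cards_draws bin_gt0.
  by case/card_gt0P => e; rewrite inE => /andP[? ?]; exists e.
have /cP/negP[] : e \in edges H by rewrite inE.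
apply/existsP; exists b; apply/forall_inP => x /sub_e.
by rewrite inE.
Qed.

Definition m (n : nat) : nat := ex_minn (realizable_ex n).

Section AbbottHansonToft.
Variables (n : nat) (C : hypergraph).

(* Disjoint union of the core vertices, of A and of B. *)
Definition AHT_vertex : finType := (C + ('I_n + 'I_n))%type.

Definition AHT_core (e : {set C}) : {set AHT_vertex} :=
  [set (inl x : AHT_vertex) | x in e].
Definition AHT_A (K : {set 'I_n}) : {set AHT_vertex} :=
  [set (inr (inl i) : AHT_vertex) | i in K].
Definition AHT_B (K : {set 'I_n}) : {set AHT_vertex} :=
  [set (inr (inr i) : AHT_vertex) | i in K].

Definition AHT_edges : {set {set AHT_vertex}} :=
  [set AHT_core e :|: AHT_A [set j] :|: AHT_B [set j]
     | e in edges C, j in [set: 'I_n]]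
  :|: [set AHT_A K :|: (AHT_B [set: 'I_n] :\: AHT_B K)
     | K : {set 'I_n} & odd #|K| && (1 <= #|K| <= n %/ 2)]
  :|: [set (AHT_A [set: 'I_n] :\: AHT_A K) :|: AHT_B K
     | K : {set 'I_n} & ~~ odd #|K| && (2 <= #|K| <= n %/ 2)]
  :|: [set AHT_A [set: 'I_n]].

Definition AHT : hypergraph := Hypergraph AHT_edges.

End AbbottHansonToft.

(* The core C is meant to be (n - 2)-uniform and non-2-colorable, with 3 <= n. *)
Definition m_AHT (C : hypergraph) (n : nat) : nat := #|edges (AHT n C)|.

(* Main.v *)
Require Import Defs.
From mathcomp Require Import all_boot.
From mathcomp Require Import boolp zify.

Set Implicit Arguments.
Unset Strict Implicit.
Unset Printing Implicit Defensive.

(** Put a hypergraph on each point of the Fano plane and take, for each line, all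
    unions of one edge from each of its three points. Every coloring gives each
    point a color in which it has a monochromatic edge; since the Fano plane is
    not 2-colorable, some line is constant, which yields a monochromatic union.
    Two points carry a minimal (k + 1)-uniform hypergraph and four a minimal
    k-uniform one. The last point, on a line with the first two, carries the
    Abbott-Hanson-Toft construction with n = k + 1 and a minimal core C: its own
    edges are used on the two lines through k-uniform points, and on the line
    through (k + 1)-uniform points one uses (k - 1)-sets instead, namely the
    edges of C and the 2^(k-1) transversals of k - 1 of the pairs {a_i, b_i}.
    Every coloring makes an edge of both kinds monochromatic in the same color.
    Replacing C by the given core H1c can only increase the number of edges. *)

(** * Sets monochromatic in a prescribed color *)

Definition mono_in (V : finType) (c : V -> bool) (b : bool) (e : {set V}) : bool :=
  [forall x in e, c x == b].

Lemma mono_in_imset (V W : finType) (f : V -> W) (c : W -> bool) b (e : {set V}) :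
  mono_in c b (f @: e) = mono_in (c \o f) b e.
Proof.
apply/forall_inP/forall_inP => [ce x xe | ce _ /imsetP[x xe ->]]; last exact: ce.
by apply: ce; apply: imset_f.
Qed.

Lemma mono_inU (V : finType) (c : V -> bool) b (e f : {set V}) :
  mono_in c b (e :|: f) = mono_in c b e && mono_in c b f.
Proof.
apply/forall_inP/andP => [cef | [/forall_inP ce /forall_inP cf] x].
  by split; apply/forall_inP => x xe; apply: cef; rewrite inE xe ?orbT.
by rewrite inE => /orP[/ce | /cf].
Qed.

Lemma mono_in1 (V : finType) (c : V -> bool) b (x : V) :
  mono_in c b [set x] = (c x == b).
Proof.
apply/forall_inP/idP => [-> // | cx y]; first by rewrite inE.
by rewrite inE => /eqP ->.
Qed.

Lemma card_setU3_disjoint (V : finType) (A B C : {set V}) :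
  [disjoint A & B] -> [disjoint A & C] -> [disjoint B & C] ->
  #|A :|: B :|: C| = #|A| + #|B| + #|C|.
Proof.
rewrite -!setI_eq0 => /eqP AB /eqP AC /eqP BC.
by rewrite cardsU setIUl AC BC setU0 cards0 subn0 cardsU AB cards0 subn0.
Qed.

Lemma disjoint_imset (U V W : finType) (f : U -> W) (g : V -> W)
    (A : {set U}) (B : {set V}) :
  (forall x y, f x <> g y) -> [disjoint f @: A & g @: B].
Proof.
move=> fg; rewrite disjoint_subset; apply/subsetP => _ /imsetP[x _ ->].
by rewrite inE; apply/imsetP => -[y _ /fg].
Qed.

(** Naming the color [b] allows edges from different points to be glued, and taking [c] as a plain
    function allows a coloring to be restricted to an embedded copy by composition. *)
Lemma non_two_colorableP (H : hypergraph) :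
  reflect (forall c : H -> bool,
             exists b, exists2 e, e \in edges H & mono_in c b e)
          (~~ two_colorable H).
Proof.
apply: (iffP existsPn) => [nH c | nH c].
  have /forall_inPn[e eH /negPn/existsP[b /forall_inP ce]] := nH (finfun c).
  exists b; exists e => //; apply/forall_inP => x /ce.
  by rewrite ffunE.
have [b [e eH ce]] := nH c.
by apply/forall_inPn; exists e => //; apply/negPn/existsP; exists b.
Qed.

Lemma m_realizable n : realizable n (m n).
Proof. by rewrite /m; case: ex_minnP => q /asboolP. Qed.

Lemma m_min (H : hypergraph) n :
  uniform n H -> ~~ two_colorable H -> m n <= #|edges H|.
Proof.
rewrite /m; case: ex_minnP => q _ qmin Hn Hc; apply: qmin.
by apply/asboolP; exists H.
Qed.

(** * Composition along the Fano plane *)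

Section FanoComposition.
Variables (T : finType) (Q R : hypergraph).

Definition fano_vertex : finType := (T + (bool * Q + bool * bool * R))%type.

Definition fano_T (e : {set T}) : {set fano_vertex} :=
  [set (inl x : fano_vertex) | x in e].
Definition fano_Q (i : bool) (e : {set Q}) : {set fano_vertex} :=
  [set (inr (inl (i, x)) : fano_vertex) | x in e].
Definition fano_R (i j : bool) (e : {set R}) : {set fano_vertex} :=
  [set (inr (inr ((i, j), x)) : fano_vertex) | x in e].

Variables F G : {set {set T}}.

(* The three perfect matchings of the four copies of R are attached to the *)
(* points T, Q_false and Q_true respectively.                              *)
Definition fano_edges : {set {set fano_vertex}} :=
  [set fano_T t.1 :|: fano_Q false t.2.1 :|: fano_Q true t.2.2
     | t in setX F (setX (edges Q) (edges Q))]
  :|: [set fano_T t.2.1 :|: fano_R t.1 false t.2.2.1 :|: fano_R t.1 true t.2.2.2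
     | t in setX [set: bool] (setX G (setX (edges R) (edges R)))]
  :|: [set fano_Q t.1.1 t.2.1 :|: fano_R false t.1.2 t.2.2.1
             :|: fano_R true (t.1.2 (+) t.1.1) t.2.2.2
     | t in setX [set: bool * bool] (setX (edges Q) (setX (edges R) (edges R)))].

Definition fano : hypergraph := Hypergraph fano_edges.

Lemma card_fano_edges :
  #|edges fano| <= #|F| * #|edges Q| ^ 2 + 2 * #|G| * #|edges R| ^ 2
                   + 4 * #|edges Q| * #|edges R| ^ 2.
Proof.
apply: leq_trans (leq_card_setU _ _) _; apply: leq_add; last first.
  apply: leq_trans (leq_imset_card _ _) _.
  by rewrite !cardsX cardsT card_prod card_bool -mulnn !mulnA.
apply: leq_trans (leq_card_setU _ _) _; apply: leq_add.
  by apply: leq_trans (leq_imset_card _ _) _; rewrite !cardsX mulnn.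
apply: leq_trans (leq_imset_card _ _) _.
by rewrite !cardsX cardsT card_bool -mulnA mulnn.
Qed.

(** The line through [T] and both copies of [Q] gives size p + 2q, the other six give q + 2r; these
    agree exactly when p + q = 2r. *)
Lemma fano_uniform p q r :
    uniform p (Hypergraph F) -> uniform q (Hypergraph G) ->
    uniform q Q -> uniform r R -> p + q = 2 * r ->
  uniform (q + 2 * r) fano.
Proof.
move=> /forall_inP Fp /forall_inP Gq /forall_inP Qq /forall_inP Rr pqr.
have cT e : #|fano_T e| = #|e| by rewrite card_imset // => x y [].
have cQ i e : #|fano_Q i e| = #|e| by rewrite card_imset // => x y [].
have cR i j e : #|fano_R i j e| = #|e| by rewrite card_imset // => x y [].
apply/forall_inP => e; rewrite !inE -orbA.
case/or3P => /imsetP[t]; rewrite !inE /=.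
- case/and3P=> /Fp/eqP t1 /Qq/eqP t2 /Qq/eqP t3 ->.
  rewrite card_setU3_disjoint ?disjoint_imset // cT !cQ t1 t2 t3.
  by apply/eqP; lia.
- case/and3P=> /Gq/eqP t1 /Rr/eqP t2 /Rr/eqP t3 ->.
  rewrite card_setU3_disjoint ?disjoint_imset // cT !cR t1 t2 t3.
  by apply/eqP; lia.
- case/and3P=> /Qq/eqP t1 /Rr/eqP t2 /Rr/eqP t3 ->.
  rewrite card_setU3_disjoint ?disjoint_imset // cQ !cR t1 t2 t3.
  by apply/eqP; lia.
Qed.

Lemma fano_non_two_colorable :
    (forall c : T -> bool, exists b,
       (exists2 e, e \in F & mono_in c b e) /\ (exists2 e, e \in G & mono_in c b e)) ->
    ~~ two_colorable Q -> ~~ two_colorable R ->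
  ~~ two_colorable fano.
Proof.
move=> FG /non_two_colorableP nQ /non_two_colorableP nR.
apply/non_two_colorableP => c.
have [t [[f fF cf] [g gG cg]]] := FG (fun x => c (inl x)).
have Qmono i : exists b, exists2 e, e \in edges Q & mono_in c b (fano_Q i e).
  have [b [e eQ ce]] := nQ (fun x => c (inr (inl (i, x)))).
  by exists b; exists e => //; rewrite mono_in_imset.
have Rmono i j : exists b, exists2 e, e \in edges R & mono_in c b (fano_R i j e).
  have [b [e eR ce]] := nR (fun x => c (inr (inr ((i, j), x)))).
  by exists b; exists e => //; rewrite mono_in_imset.
have {}cf : mono_in c t (fano_T f) by rewrite mono_in_imset.
have {}cg : mono_in c t (fano_T g) by rewrite mono_in_imset.
have lineTQ q q' : q \in edges Q -> q' \in edges Q ->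
    mono_in c t (fano_Q false q) -> mono_in c t (fano_Q true q') ->
  exists b, exists2 e, e \in edges fano & mono_in c b e.
  move=> qQ qQ' cq cq'; exists t.
  exists (fano_T f :|: fano_Q false q :|: fano_Q true q').
    by rewrite !inE -orbA; apply/or3P/Or31/imsetP; exists (f, (q, q'));
       rewrite ?inE /= ?fF ?qQ.
  by rewrite !mono_inU cf cq.
have lineTR i r r' : r \in edges R -> r' \in edges R ->
    mono_in c t (fano_R i false r) -> mono_in c t (fano_R i true r') ->
  exists b, exists2 e, e \in edges fano & mono_in c b e.
  move=> rR rR' cr cr'; exists t.
  exists (fano_T g :|: fano_R i false r :|: fano_R i true r').
    by rewrite !inE -orbA; apply/or3P/Or32/imsetP; exists (i, (g, (r, r')));
       rewrite ?inE /= ?gG ?rR.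
  by rewrite !mono_inU cg cr.
have lineQR i j b q r r' : q \in edges Q -> r \in edges R -> r' \in edges R ->
    mono_in c b (fano_Q i q) -> mono_in c b (fano_R false j r) ->
    mono_in c b (fano_R true (j (+) i) r') ->
  exists b, exists2 e, e \in edges fano & mono_in c b e.
  move=> qQ rR rR' cq cr cr'; exists b.
  exists (fano_Q i q :|: fano_R false j r :|: fano_R true (j (+) i) r').
    by rewrite !inE -orbA; apply/or3P/Or33/imsetP; exists ((i, j), (q, (r, r')));
       rewrite ?inE /= ?qQ ?rR.
  by rewrite !mono_inU cq cr.
have [q0 [a aQ ca]] := Qmono false; have [q1 [a' aQ' ca']] := Qmono true.
have [r00 [d00 R00 c00]] := Rmono false false.
have [r01 [d01 R01 c01]] := Rmono false true.
have [r10 [d10 R10 c10]] := Rmono true false.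
have [r11 [d11 R11 c11]] := Rmono true true.
have [/andP[/eqP ? /eqP ?]|T0] := boolP ((q0 == t) && (q1 == t)).
  by subst; apply: (lineTQ a a').
have [/andP[/eqP ? /eqP ?]|T1] := boolP ((r00 == t) && (r01 == t)).
  by subst; apply: (lineTR false d00 d01).
have [/andP[/eqP ? /eqP ?]|T2] := boolP ((r10 == t) && (r11 == t)).
  by subst; apply: (lineTR true d10 d11).
have [/andP[/eqP ? /eqP ?]|Q0] := boolP ((r00 == q0) && (r10 == q0)).
  by subst; apply: (lineQR false false q0 a d00 d10).
have [/andP[/eqP ? /eqP ?]|Q1] := boolP ((r01 == q0) && (r11 == q0)).
  by subst; apply: (lineQR false true q0 a d01 d11).
have [/andP[/eqP ? /eqP ?]|Q2] := boolP ((r00 == q1) && (r11 == q1)).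
  by subst; apply: (lineQR true false q1 a' d00 d11).
have [/andP[/eqP ? /eqP ?]|Q3] := boolP ((r01 == q1) && (r10 == q1)).
  by subst; apply: (lineQR true true q1 a' d01 d10).
(* The hypotheses [T0] to [Q3] say that none of the seven lines is constant; all 2^7 colorings of
   the points are refuted. *)
by case: t q0 q1 r00 r01 r10 r11 T0 T1 T2 Q0 Q1 Q2 Q3
  {cf cg ca ca' c00 c01 c10 c11 lineTQ lineTR}
  => -[] [] [] [] [] [].
Qed.

End FanoComposition.

(** * Edges of the Abbott-Hanson-Toft construction as transversals *)

Section AbbottHansonToftEdges.
Variables (n : nat) (C : hypergraph).
Implicit Types K D : {set 'I_n}.

(** Edges of types (ii) to (iv) meet each pair {a_i, b_i} in exactly one vertex, so the set [K] of
    indices where a_i is chosen encodes them uniformly. *)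
Definition AHT_side K (i : 'I_n) : AHT_vertex n C :=
  inr (if i \in K then inl i else inr i).

Definition AHT_transversal K D : {set AHT_vertex n C} :=
  [set AHT_side K i | i in D].

(* Since the transversals of type (iii) are those of the complements ~: K, and *)
(* type (iv) is K = setT, a transversal K is an edge exactly in this case.     *)
Definition AHT_admissible : {set {set 'I_n}} :=
  [set K : {set 'I_n} | odd #|K| && (#|K| <= n %/ 2) || ~~ odd #|~: K| && (#|~: K| <= n %/ 2)].

Definition AHT_core_edge (e : {set C}) (j : 'I_n) : {set AHT_vertex n C} :=
  AHT_core n e :|: AHT_A C [set j] :|: AHT_B C [set j].

Lemma AHT_side_inj K : injective (AHT_side K).
Proof. by move=> i j []; case: ifP; case: ifP => // _ _ []. Qed.

Lemma card_AHT_transversal K D : #|AHT_transversal K D| = #|D|.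
Proof. by rewrite card_imset //; apply: AHT_side_inj. Qed.

(** Hence subsets of [D] index all transversals over [D], which bounds their number by 2^|D|. *)
Lemma AHT_transversalI K D : AHT_transversal K D = AHT_transversal (K :&: D) D.
Proof. by apply: eq_in_imset => i iD; rewrite /AHT_side inE iD andbT. Qed.

Lemma AHT_transversalE K :
  AHT_transversal K setT = AHT_A C K :|: (AHT_B C [set: 'I_n] :\: AHT_B C K).
Proof.
apply/setP => x; rewrite !inE; apply/imsetP/orP.
  case=> i _ ->; rewrite /AHT_side; case: ifPn => iK.
    by left; apply: imset_f.
  right; apply/andP; split; last exact: imset_f.
  apply/imsetP => -[j jK [ij]].
  by rewrite ij jK in iK.
case=> [/imsetP[i iK ->] | /andP[xK /imsetP[i _ xE]]].
  by exists i; rewrite // /AHT_side iK.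
exists i => //; rewrite xE /AHT_side ifN //.
by apply: contra xK => iK; rewrite xE imset_f.
Qed.

Lemma AHT_transversalCE K :
  AHT_transversal (~: K) setT = (AHT_A C [set: 'I_n] :\: AHT_A C K) :|: AHT_B C K.
Proof.
apply/setP => x; rewrite !inE; apply/imsetP/orP.
  case=> i _ ->; rewrite /AHT_side inE; case: (boolP (i \in K)) => iK /=.
    by right; apply: imset_f.
  left; apply/andP; split; last exact: imset_f.
  apply/imsetP => -[j jK [ij]].
  by rewrite ij jK in iK.
case=> [/andP[xK /imsetP[i _ xE]] | /imsetP[i iK ->]]; last first.
  by exists i; rewrite // /AHT_side inE iK.
exists i => //; rewrite xE /AHT_side inE ifT //.
by apply: contra xK => iK; rewrite xE imset_f.
Qed.

Lemma AHT_edgesE :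
  AHT_edges n C = [set AHT_core_edge e j | e in edges C, j in [set: 'I_n]]
                  :|: [set AHT_transversal K setT | K in AHT_admissible].
Proof.
rewrite /AHT_edges -!setUA; congr setU; apply/setP => x; rewrite !inE.
apply/or3P/imsetP.
  case=> [/imsetP[K] | /imsetP[K] | /eqP ->].
  - rewrite !inE => /and3P[oK _ Kn] ->; exists K; last by rewrite AHT_transversalE.
    by rewrite inE oK Kn.
  - rewrite !inE => /and3P[oK _ Kn] ->.
    exists (~: K); last by rewrite AHT_transversalCE.
    by rewrite inE setCK oK Kn orbT.
  - exists setT; first by rewrite inE setCT cards0 orbT.
    by rewrite AHT_transversalE setDv setU0.
case=> K; rewrite inE => /orP[] /andP[oK Kn] ->.
  constructor 1; apply/imsetP; exists K; last exact: AHT_transversalE.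
  by rewrite inE oK Kn andbT; case: #|K| oK.
(* Type (iii) starts at size 2, so an empty complement is covered by the edge A of type (iv). *)
have [K0 | K0] := eqVneq #|~: K| 0.
  constructor 3; have -> : K = setT.
    by rewrite -[K]setCK; move/cards0_eq: K0 => ->; rewrite setC0.
  by rewrite AHT_transversalE setDv setU0.
constructor 2; apply/imsetP; exists (~: K); last by rewrite -AHT_transversalCE setCK.
by rewrite inE oK Kn andbT; case: #|~: K| oK K0 => [|[]].
Qed.

Lemma AHT_transversal_inj : injective (AHT_transversal^~ setT).
Proof.
move=> K L KL; apply/setP => i.
have memE M : (inr (inl i) \in AHT_transversal M setT) = (i \in M).
  rewrite AHT_transversalE inE [X in _ || X](_ : _ = false) ?orbF.
    by rewrite mem_imset // => x y [].
  by apply/negbTE; rewrite inE negb_and; apply/orP; right; apply/imsetP => -[].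
by rewrite -!memE; move: KL => /= ->.
Qed.

Lemma AHT_uniform p : uniform p C -> n = p.+2 -> uniform n (AHT n C).
Proof.
move=> /forall_inP Cp np; apply/forall_inP => e.
rewrite /= AHT_edgesE inE => /orP[/imset2P[f j fC _ ->] | /imsetP[K _ ->]]; last first.
  by rewrite card_AHT_transversal cardsT card_ord.
rewrite card_setU3_disjoint ?disjoint_imset // !card_imset; try by move=> ? ? [].
by rewrite (eqP (Cp _ fC)) !cards1 np !addn1.
Qed.

(** Core edges are nonempty, so type (i) edges contain core vertices and transversals do not; the
    pair (e, j) is read off from the core vertices and the a-vertex. The count thus depends on the
    core only through its number of edges. *)
Lemma card_AHT_edges p : uniform p.+1 C ->
  #|edges (AHT n C)| = #|edges C| * n + #|AHT_admissible|.
Proof.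
move=> /forall_inP Cp; rewrite /= AHT_edgesE cardsU.
rewrite (_ : _ :&: _ = set0) ?cards0 ?subn0; last first.
  apply/setP => x; rewrite !inE; apply/negbTE/andP.
  case=> /imset2P[e j eC _ ->] /imsetP[K _ eK].
  have [y ye] : exists y, y \in e by apply/card_gt0P; rewrite (eqP (Cp _ eC)).
  have : inl y \in AHT_transversal K setT by rewrite -eK !inE imset_f.
  by case/imsetP.
congr addn; last by rewrite card_imset //; apply: AHT_transversal_inj.
rewrite curry_imset2X card_imset; first by rewrite cardsX cardsT card_ord.
have memC e j y : (inl y \in AHT_core_edge e j) = (y \in e).
  rewrite !inE mem_imset; last by move=> ? ? [].
  have nA (f : _ -> AHT_vertex n C) : (forall i, f i <> inl y) ->
      inl y \in f @: [set j] = false.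
    by move=> fy; apply/imsetP => -[i _ /esym/fy].
  by rewrite !nA ?orbF.
have memA e j i : (inr (inl i) \in AHT_core_edge e j) = (i == j).
  rewrite !inE /AHT_A imset_set1 inE.
  have -> : (inr (inl i) \in AHT_core n e) = false by apply/imsetP => -[].
  have -> : (inr (inl i) \in AHT_B C [set j]) = false by apply/imsetP => -[].
  by rewrite orbF.
move=> [e j] [f i] /= ef; congr pair.
  by apply/setP => y; rewrite -(memC _ j) ef memC.
by apply/eqP; rewrite -(memA f) -ef memA.
Qed.

(* If the core is monochromatic in b, either b wins through some pair           *)
(* {a_j, b_j}, or every pair contains a vertex of color ~~ b. In the latter     *)
(* case, either all pairs are bichromatic, so that both colors have a           *)
(* transversal, or there are two ~~ b transversals of sizes differing by one,   *)
(* one of which is an edge.                                                     *)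
Lemma AHT_mono : ~~ two_colorable C -> forall c : AHT_vertex n C -> bool,
  exists b, (exists2 e, e \in edges (AHT n C) & mono_in c b e) /\
    ((exists2 e, e \in edges C & mono_in c b (AHT_core n e)) \/
     (exists K, mono_in c b (AHT_transversal K setT))).
Proof.
move=> /non_two_colorableP nC c.
have [b [e eC ce]] := nC (fun x => c (inl x)).
have {}ce : mono_in c b (AHT_core n e) by rewrite mono_in_imset.
pose al i := c (inr (inl i)); pose be i := c (inr (inr i)).
have [/existsP[j /andP[aj bj]] | /existsPn nred] :=
    boolP [exists j, (al j == b) && (be j == b)].
  exists b; split; last by left; exists e.
  exists (AHT_core_edge e j).
    by rewrite /= AHT_edgesE inE; apply/orP; left; apply: imset2_f; rewrite ?inE.
  by rewrite !mono_inU ce /AHT_A /AHT_B !imset_set1 !mono_in1 [c _ == _]aj.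
have edgeT K : K \in AHT_admissible -> AHT_transversal K setT \in edges (AHT n C).
  by move=> aK; rewrite /= AHT_edgesE inE; apply/orP; right; apply: imset_f.
have monoT d K : (forall i, (if i \in K then al i else be i) = d) ->
    mono_in c d (AHT_transversal K setT).
  move=> Kd; rewrite mono_in_imset; apply/forall_inP => i _ /=.
  by rewrite /AHT_side -(Kd i); case: ifP.
(* An admissible transversal serves both as the edge and as the transversal. *)
suff [d [K aK cK]] : exists d, exists2 K, K \in AHT_admissible &
    mono_in c d (AHT_transversal K setT).
  by exists d; split; [exists (AHT_transversal K setT); rewrite ?edgeT | right; exists K].
have cardCK K : #|K| + #|~: K| = n by rewrite cardsC card_ord.
have [/existsP[j /andP[/eqP aj /eqP bj]] | /existsPn nblue] :=
    boolP [exists j, (al j == ~~ b) && (be j == ~~ b)].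
  exists (~~ b).
  pose K : {set 'I_n} := [set i | al i == ~~ b].
  have jK : j \in K by rewrite inE aj.
  have cK : mono_in c (~~ b) (AHT_transversal K setT).
    apply: monoT => i; rewrite inE; move: (nred i).
    by case: (al i) (be i) (b) => [] [] [].
  (* Both vertices of pair [j] have color [~~ b], so a_j may be exchanged for b_j. *)
  have cKj : mono_in c (~~ b) (AHT_transversal (K :\ j) setT).
    apply: monoT => i; rewrite !inE; have [-> //=|/=] := eqVneq i j.
    by move: (nred i); case: (al i) (be i) (b) => [] [] [].
  have [aK | naK] := boolP (K \in AHT_admissible); first by exists K.
  (* One of [K], [~: K] has size at most n/2, with the wrong parity as [K] is not admissible;
     removing [j] flips both parities. *)
  exists (K :\ j) => //; move: naK.
  have := cardCK K; have := cardCK (K :\ j); have := cardsD1 j K; rewrite jK !inE.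
  move: #|K| #|~: K| #|K :\ j| #|~: (K :\ j)| => s s' t t'; lia.
pose K : {set 'I_n} := [set i | al i == b].
have [aK | naK] := boolP (K \in AHT_admissible).
  exists b; exists K => //; apply: monoT => i; rewrite inE.
  by move: (nred i) (nblue i); case: (al i) (be i) (b) => [] [] [].
(* Whichever of [K], [~: K] has size at most n/2, its parity makes either [K] or [~: K]
   admissible. *)
exists (~~ b); exists (~: K).
  by move: naK; have := cardCK K; rewrite !inE setCK; lia.
apply: monoT => i; rewrite !inE.
by move: (nred i) (nblue i); case: (al i) (be i) (b) => [] [] [].
Qed.

End AbbottHansonToftEdges.

(** * Comparison of cores and assembly of the bound *)

Lemma AHT_edges_mono n p (C C' : hypergraph) :
    uniform p.+1 C -> uniform p.+1 C' -> #|edges C| <= #|edges C'| ->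
  m_AHT C n <= m_AHT C' n.
Proof.
move=> Cp Cp' CC'.
by rewrite /m_AHT (card_AHT_edges n Cp) (card_AHT_edges n Cp') leq_add2r leq_mul2r CC' orbT.
Qed.

Theorem mainTheorem3 (k : nat) (H1c : hypergraph) (hk : 2 <= k)
    (H1c_uniform : uniform (k - 1) H1c)
    (H1c_non2col : ~~ two_colorable H1c) :
  m (3 * k + 1) <=
    (m (k - 1) + 2 ^ (k - 1)) * m (k + 1) ^ 2
    + 2 * m_AHT H1c (k + 1) * m k ^ 2
    + 4 * m (k + 1) * m k ^ 2.
Proof.
case: k hk H1c_uniform => [|[|j]] // _.
rewrite subn1 !addn1 => H1cU.
have [C [CU nC Cm]] := m_realizable j.+1.
have [Q [QU nQ Qm]] := m_realizable j.+3.
have [R [RU nR Rm]] := m_realizable j.+2.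
(* With k = j + 2, [D] selects the first k - 1 of the k + 1 pairs. *)
pose D : {set 'I_j.+3} := [set widen_ord (leq_addl 2 j.+1) i | i in 'I_j.+1].
have cardD : #|D| = j.+1.
  by rewrite card_imset ?card_ord // => x y /(congr1 val) /= /val_inj.
pose F := [set AHT_core j.+3 e | e in edges C]
          :|: [set AHT_transversal C K D | K in powerset D].
pose G := edges (AHT j.+3 C).
have FU : uniform j.+1 (Hypergraph F).
  apply/forall_inP => e; rewrite inE => /orP[] /imsetP[x xC ->].
    by rewrite card_imset; [exact: (forall_inP CU) | move=> ? ? []].
  by rewrite card_AHT_transversal cardD.
have cardF : #|F| <= m j.+1 + 2 ^ j.+1.
  apply: leq_trans (leq_card_setU _ _) _.
  rewrite -Cm -[in 2 ^ _]cardD -card_powerset.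
  by apply: leq_add; apply: leq_imset_card.
have FG c : exists b, (exists2 e, e \in F & mono_in c b e) /\
                      (exists2 e, e \in G & mono_in c b e).
  have [b [Gb [[e eC ce] | [K cK]]]] := AHT_mono nC c; exists b; split=> //.
    by exists (AHT_core j.+3 e); rewrite // inE imset_f.
  exists (AHT_transversal C (K :&: D) D).
    by rewrite inE; apply/orP; right; apply: imset_f; rewrite inE subsetIr.
  rewrite -AHT_transversalI; move: cK; rewrite !mono_in_imset => /forall_inP cK.
  by apply/forall_inP => i _; apply: cK.
have GU : uniform j.+3 (Hypergraph G) by apply: AHT_uniform CU _.
have fanoU : uniform (j.+3 + 2 * j.+2) (fano Q R F G).
  (* The size condition is (k - 1) + (k + 1) = 2k. *)
  by apply: fano_uniform FU GU QU RU _; lia.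
have -> : (3 * j.+2).+1 = j.+3 + 2 * j.+2 by lia.
apply: leq_trans (m_min fanoU (fano_non_two_colorable FG nQ nR)) _.
apply: leq_trans (card_fano_edges _ _ _ _) _; rewrite Qm Rm.
rewrite leq_add2r leq_add // leq_mul2r ?cardF ?orbT //.
rewrite leq_mul2l (AHT_edges_mono _ CU H1cU) ?orbT //.
by rewrite Cm m_min.
Qed.
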